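(* Let $G$ be a group, let $G+_{\partial_E}Ends(G)$ be its Freudenthal compactification and let $p \in Ends(G)$ be a bounded parabolic point of $G+_{\partial_{E}}Ends(G)$. Then $\#Ends(Stab\ p) = 1$.
   Context: Groups are discrete. An action of a group $H$ on a locally compact Hausdorff space $V$ is properly discontinuous if for every compact $K\subseteq V$ the set $\{h\in H: hK\cap K\neq\emptyset\}$ is finite, and cocompact if $HK=V$ for some compact $K\subseteq V$. A point $p$ of a compact Hausdorff $G$-space $Z$ is bounded parabolic if $Stab\ p$ acts properly discontinuously and cocompactly on $Z\setminus\{p\}$. For an entourage $u$ of the unique uniform structure compatible with a compact Hausdorff space, a subset $A$ is $u$-small if $A\times A\subseteq u$. A perspective compactification of a discrete group $H$ is a compact Hausdorff space $H\sqcup Y$ in which $H$ is discrete, open and dense, with an action of $H$ by homeomorphisms extending left multiplication, such that for every entourage $u$ and every finite $F\subseteq H$ the set $\{h\in H: hF\text{ is not }u\text{-small}\}$ is finite. The Freudenthal compactification $H+_{\partial_E}Ends(H)$ is the maximal perspective compactification of $H$ with totally disconnected boundary: for any perspective compactification $H\sqcup Y$ with $Y$ totally disconnected there is a unique continuous (equivariant) map $H+_{\partial_E}Ends(H)\to H\sqcup Y$ that is the identity on $H$. $Ends(H)$ is its boundary. *)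

(* Defs.v *)
From HB Require Import structures.
From mathcomp Require Import all_boot.
From mathcomp Require Import boolp classical_sets functions cardinality.
From mathcomp Require Import topology.

Set Implicit Arguments.
Unset Strict Implicit.
Unset Printing Implicit Defensive.

Local Open Scope classical_set_scope.
Local Open Scope group_scope.

(* All groups are discrete, so continuity of an action is continuity of each
   g; since g^-1 also acts continuously, each g is then a homeomorphism. *)
Record continuous_action (G : groupType) (X : topologicalType) := {
  act :> G -> X -> X;
  act1 : forall x, act 1 x = x;
  actM : forall g h x, act (g * h) x = act g (act h x);
  act_continuous : forall g, continuous (act g)
}.

Section Stabiliser.
Variables (G : groupType) (X : topologicalType).
Variables (a : continuous_action G X) (p : X).

Definition stab_pred : {pred G} := fun g => `[< a g p = p >].

Definition stab := {g : G | g \in stab_pred}.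

Lemma stab_group_closed : group_closed stab_pred.
Proof.
split; first by apply/asboolP; exact: act1.
move=> g h /asboolP gp /asboolP hp; apply/asboolP.
by rewrite -[in LHS]hp -actM divgK.
Qed.

HB.instance Definition _ := SubChoice.on stab.
HB.instance Definition _ :=
  SubChoice_isSubGroup.Build G stab_pred stab stab_group_closed.

Definition stab_act (h : stab) (x : X) : X := a (\val h) x.

End Stabiliser.

(* The action of H on V is given by the restriction to V of a map
   H -> X -> X; compactness of K `<=` V does not depend on whether K is seen
   as a subspace of V or of X. *)
Definition properly_discontinuous_on (H : Type) (X : topologicalType)
    (a : H -> X -> X) (V : set X) :=
  forall K : set X, compact K -> K `<=` V ->
    finite_set [set h | (a h @` K) `&` K !=set0].

Definition cocompact_on (H : Type) (X : topologicalType)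
    (a : H -> X -> X) (V : set X) :=
  exists K : set X, [/\ compact K, K `<=` V & \bigcup_h (a h @` K) = V].

Definition bounded_parabolic (G : groupType) (X : topologicalType)
    (a : continuous_action G X) (p : X) :=
  properly_discontinuous_on (stab_act (a := a) (p := p)) (~` [set p]) /\
  cocompact_on (stab_act (a := a) (p := p)) (~` [set p]).

Definition small (X : Type) (u : set (X * X)) (A : set X) := A `*` A `<=` u.

(* H \sqcup Y is presented as a space with an injection pc_inj of H.  The
   carrier is a uniformType: being compact Hausdorff, its uniform structure is
   the unique one compatible with its topology.  pc_isolated says that H is
   discrete and open. *)
Record perspective_compactification (H : groupType) := {
  pc_space :> uniformType;
  pc_compact : compact [set: pc_space];
  pc_hausdorff : hausdorff_space pc_space;
  pc_inj : H -> pc_space;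
  pc_injective : injective pc_inj;
  pc_isolated : forall h, open [set pc_inj h];
  pc_dense : dense (range pc_inj);
  pc_act : continuous_action H pc_space;
  pc_act_inj : forall g h, pc_act g (pc_inj h) = pc_inj (g * h);
  pc_perspective : forall (u : set (pc_space * pc_space)) (F : set H),
    entourage u -> finite_set F ->
    finite_set [set h | ~ small u (pc_inj @` [set h * f | f in F])]
}.

Definition pc_boundary (H : groupType) (X : perspective_compactification H) :
  set X := ~` range (pc_inj X).

Arguments pc_boundary {H} X.

Definition extends_id (H : groupType) (X Z : perspective_compactification H)
    (f : X -> Z) :=
  continuous f /\ forall h, f (pc_inj X h) = pc_inj Z h.

Definition equivariant (H : groupType) (X Z : perspective_compactification H)
    (f : X -> Z) :=
  forall h x, f (pc_act X h x) = pc_act Z h (f x).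

(* Uniqueness is among all continuous maps extending the identity of H, not
   only the equivariant ones. *)
Definition is_freudenthal (H : groupType)
    (X : perspective_compactification H) :=
  totally_disconnected (pc_boundary X) /\
  forall Z : perspective_compactification H,
    totally_disconnected (pc_boundary Z) ->
    exists f : X -> Z, [/\ extends_id f, equivariant f &
      forall f' : X -> Z, extends_id f' -> f' = f].

(* Main.v *)
(** Call a subset of a group almost invariant if every right translation changes
it by finitely many elements.  A clopen subset of a perspective compactification
has an almost invariant trace on the group.  Conversely every almost invariant
set is the trace of a clopen subset of the Freudenthal compactification, because
the latter maps to the Stone space of the Boolean algebra of almost invariant
sets.

If Stab p had two ends, a clopen set would separate them and give an almost
invariant A in Stab p, infinite with infinite complement.  As Stab p acts
properly and cocompactly off p, some clopen L avoiding p has translates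
covering the complement of p, and the x in G such that x \in h L implies
h \in A form an almost invariant subset of G.  It agrees with A on Stab p up
to finitely many elements, so both it and its complement accumulate at p, which
is impossible if it is the trace of a clopen set. *)
Require Import Defs.
From HB Require Import structures.
From mathcomp Require Import all_boot finmap.
From mathcomp Require Import boolp classical_sets functions cardinality.
From mathcomp Require Import filter topology.

Set Implicit Arguments.
Unset Strict Implicit.
Unset Printing Implicit Defensive.

Local Open Scope classical_set_scope.
Local Open Scope card_scope.
Local Open Scope group_scope.

(** * Quasicomponents and zero-dimensionality *)

Definition quasicomponent (T : topologicalType) (x : T) : set T :=
  [set y | forall C, clopen C -> C x -> C y].

(** The clopen sets containing [x] are stable under intersection, so by compactness a cover of [K]
    by their complements reduces to a single one. *)
Lemma quasicomponent_compactP (T : topologicalType) (x : T) (K : set T) :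
  compact K -> K `&` quasicomponent x = set0 ->
  exists2 C, clopen C /\ C x & K `<=` ~` C.
Proof.
move=> /compact_near_coveringP cK KQ.
pose F := filter_from [set D : set T | D x /\ clopen D] id.
have FF : Filter F.
  apply: filter_from_filter; first by exists setT; split => //; exact: clopenT.
  by move=> A B [? ?] [? ?]; exists (A `&` B) => //; split=> //; exact: clopenI.
have PF : ProperFilter F by apply: filter_from_proper; move=> ? [? _]; exists x.
have [|D [DF _ [C DC]] /(_ _ DC) KC] :=
    cK _ _ (fun U => ~` U) (powerset_filter_from_filter PF).
  move=> y Ky; have : ~ quasicomponent x y.
    by move=> Qy; rewrite -[False]/(@set0 T y) -KQ.
  move=> /existsNP[C /not_implyP[[oC cC] /not_implyP[Cx Cy]]].
  exists (~` C, [set U | U `<=` C]); first split.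
  - by apply: open_nbhs_nbhs; split => //; exact: closed_openC.
  - apply/near_powerset_filter_fromP; first by move=> ? ?; exact: subset_trans.
    by exists C => //; exists C.
  - by case=> i j [? /subsetC]; apply.
have [B [Bx cB] BC] := DF _ DC.
by exists B => //; exact: subset_trans KC (subsetC BC).
Qed.

Lemma quasicomponent_connected (T : topologicalType) (x : T) :
  hausdorff_space T -> compact [set: T] -> connected (quasicomponent x).
Proof.
move=> hT cT; set Q := quasicomponent x.
have Qx : Q x by [].
(* Normality puts [P] in an open [U] whose closure misses [R]. The frontier of [U] misses [Q], so
   some clopen [C] containing [x] misses that frontier. Then [C] meets [U] in a clopen set
   containing [x], hence containing [Q]. *)
have half (P R : set T) : closed P -> closed R -> P `&` R = set0 ->
    Q `<=` P `|` R -> P x -> Q `<=` P.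
  move=> clP clR PR0 QPR Px.
  have nR : set_nbhs P (~` R).
    apply/set_nbhsP; exists (~` R); split => //; first exact: closed_openC.
    exact/disjoints_subset.
  have [V /set_nbhsP[U [oU PU UV]] VR] := compact_normal hT cT clP nR.
  have UR : closure U `<=` ~` R := subset_trans (closureS UV) VR.
  have cK : compact (closure U `\` U).
    apply: (subclosed_compact _ cT) => //.
    by apply: closedI; [exact: closed_closure | exact: open_closedC].
  have [|C [[oC cC] Cx] KC] := quasicomponent_compactP (x := x) cK.
    rewrite -subset0 => z [[Uz nUz] /QPR[/PU//|]]; exact: UR.
  have CU : clopen (C `&` U).
    split; first exact: openI.
    rewrite (_ : C `&` U = C `&` closure U);
      first by apply: closedI => //; exact: closed_closure.
    rewrite eqEsubset; split=> z [Cz Uz]; split=> //.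
      exact: subset_closure.
    by apply: contrapT => nUz; exact: (KC z).
  move=> z Qz; have [|_ /subset_closure/UR Rz] := Qz _ CU.
    by split; [|exact: PU].
  by case: (QPR _ Qz).
move=> B [b Bb] [U oU BU] [D clD BD]; rewrite eqEsubset; split.
  by rewrite BU; exact: subIsetl.
have clQ : closed Q.
  rewrite (_ : Q = \bigcap_(C in [set C : set T | clopen C /\ C x]) C).
    by apply: closed_bigI => C [[]].
  by rewrite eqEsubset; split=> z Qz C; [case|move=> cC Cx]; exact: Qz.
have clB : closed B by rewrite BD; exact: closedI.
have clB' : closed (Q `\` U) by apply: closedI => //; exact: open_closedC.
have QB : Q `<=` B `|` (Q `\` U).
  by move=> z Qz; have [Uz|Uz] := pselect (U z); [left; rewrite BU|right].
have BB : B `&` (Q `\` U) = set0 by rewrite BU -subset0 => z [[_ Uz] []].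
have [Bx|Rx] := QB _ Qx; first exact: half clB clB' BB QB Bx.
have QU : Q `<=` Q `\` U by apply: (half _ B); rewrite // 1?setIC 1?setUC.
by move: Bb; rewrite BU => -[/QU[]].
Qed.

(* In a compact Hausdorff space quasicomponents are connected, and that of a
   point of Y lies in Y. *)
Lemma isolated_zero_dimensional (T : topologicalType) (Y : set T) :
  hausdorff_space T -> compact [set: T] -> totally_disconnected Y ->
  (forall z, ~ Y z -> open [set z]) -> zero_dimensional T.
Proof.
move=> hT cT tdY oY x y xy.
have clo z : ~ Y z -> clopen [set z].
  move=> nYz; split; first exact: oY.
  exact: accessible_closed_set1 (hausdorff_accessible hT) z.
have [Yx|nYx] := pselect (Y x); last first.
  by exists [set x]; split; [exact: clo| |exact/nesym/eqP].
apply: contrapT => nC; have Qy : quasicomponent x y.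
  by move=> C cC Cx; apply: contrapT => Cy; apply: nC; exists C.
suff : [set x] y by exact/nesym/eqP.
rewrite -(tdY _ Yx); exists (quasicomponent x) => //; split => //.
  move=> z Qz; apply: contrapT => nYz.
  have xz : (~` [set z]) x by move=> xz; apply: nYz; rewrite -xz.
  exact: Qz (clopenC Y (clo _ nYz)) xz _.
exact: quasicomponent_connected.
Qed.

(** * Clopen sets and almost invariant sets *)

Lemma clopen_entourage (T : uniformType) (C : set T) :
  compact [set: T] -> clopen C -> entourage [set z : T * T | C z.1 <-> C z.2].
Proof.
move=> /compact_near_coveringP cT [oC cC].
(* Without a point the entourage filter is not proper, so the empty space is treated apart. *)
have [x0|T0] := pselect (exists x : T, True); last first.
  by apply: filterS filterT => z; case: T0; exists z.1.
have PE : ProperFilter (@entourage T).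
  split; last exact: entourage_filter'.
  by case: x0 => x _ E0; exact: (entourage_refl x E0).
(* Each point has its own scale at which [D] is not left; compactness makes the scale uniform. The
   complement of [C] supplies the converse implication. *)
have half (D : set T) : clopen D -> entourage [set z : T * T | D z.1 -> D z.2].
  move=> [oD cD]; pose P E y := forall w : T, E (y, w) -> D y -> D w.
  have [] := cT _ _ P (powerset_filter_from_filter PE).
    move=> x _; have [Dx|nDx] := pselect (D x).
      have /nbhsP[E entE ED] : nbhs x D by apply: open_nbhs_nbhs.
      have entE' := entourage_split_ent entE.
      exists (xsection (split_ent E) x, [set E' | E' `<=` split_ent E]).
        split; first exact: nbhs_entourage.
        apply/near_powerset_filter_fromP; last by exists (split_ent E).
        by move=> ? ?; exact: subset_trans.
      move=> [y E'] [/= /xsectionP xy E'E] w /E'E yw _; apply/ED/xsectionP.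
      exact: (entourage_split y).
    exists (~` D, setT); last by move=> [y E] [/= nDy _] w _ /nDy.
    split; last exact: filterT.
    by apply: open_nbhs_nbhs; split => //; exact: closed_openC.
  move=> F [FE _ [E FEE]] /(_ _ FEE) H.
  by apply: filterS (FE _ FEE) => -[y w] Eyw; exact: (H y I w Eyw).
have cC' : clopen (~` C) by apply: clopenC => //; split.
apply: filterS (filterI (half C _) (half _ cC')); last by split.
by move=> [y w] /= [yw nyw]; split=> // Cw; apply: contrapT => /nyw; exact.
Qed.

Definition almost_invariant (G : groupType) (A : set G) :=
  forall k, finite_set [set h | ~ (A h <-> A (h * k))].

Lemma almost_invariant_lmul (G : groupType) (A : set G) (g : G) :
  almost_invariant A -> almost_invariant [set x | A (g * x)].
Proof.
move=> aA k; apply: sub_finite_set (finite_image (fun x => g^-1 * x) (aA k)).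
by move=> h /= nA; exists (g * h); [rewrite /= -mulgA|rewrite mulKg].
Qed.

Lemma almost_invariant_lmulE (G : groupType) (A : set G) (g : G) :
  almost_invariant [set x | A (g * x)] = almost_invariant A.
Proof.
apply/propext; split; last exact: almost_invariant_lmul.
move=> /(@almost_invariant_lmul _ _ g^-1); congr almost_invariant.
by apply/funext => x /=; rewrite mulVKg.
Qed.

Lemma almost_invariant1 (G : groupType) (g : G) : almost_invariant [set g].
Proof.
move=> k; apply: sub_finite_set (finite_set2 g (g * k^-1)) => h /= nA.
have [->|hg] := pselect (h = g); first by left.
have [<-|hkg] := pselect (h * k = g); first by right; rewrite mulgK.
by case: nA; split.
Qed.

(** Perspectivity is applied to the finite set of [1] and [k] and to the entourage of pairs on the
    same side of [C]. *)
Lemma clopen_almost_invariant (G : groupType)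
    (X : perspective_compactification G) (C : set X) :
  clopen C -> almost_invariant (pc_inj X @^-1` C).
Proof.
move=> cC k; have /pc_perspective := clopen_entourage (@pc_compact _ X) cC.
move=> /(_ [set 1; k] (finite_set2 _ _)); apply: sub_finite_set => h /= nC sm.
apply: nC; apply: (sm (pc_inj X h, pc_inj X (h * k))); split => /=.
  by exists h => //; exists 1; rewrite ?mulg1 //; left.
by exists (h * k) => //; exists k => //; right.
Qed.

(** * Powers of the two-point space *)

Section cube.
Variable I : choiceType.
Local Notation cube := {ptws I -> bool}.

Lemma cube_continuous (T : topologicalType) (f : T -> cube) :
  (forall i, continuous (fun t => f t i)) -> continuous f.
Proof.
move=> cf t; apply/cvg_sup => i.
exact: (@continuous_comp_initial _ T _ (fun g : cube => g i) f (cf i) t).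
Qed.

(** A basic entourage of the product is a finite intersection of pullbacks along coordinates. *)
Lemma cube_entourage (u : set (cube * cube)) : entourage u ->
  exists2 s : set I, finite_set s &
    forall x y : cube, (forall i, s i -> x i = y i) -> u (x, y).
Proof.
move=> [B [F _ <-] BF]; exists ((fun p => (projT1 p).1) @` [set` F]).
  exact: finite_image.
move=> x y xy; apply: BF => -[[i E] p] /= FE.
have [V entV VE] := asboolW p; apply: VE => /=.
change (V (x i, y i)); rewrite xy; first exact: entourage_refl.
by exists (exist _ (i, E) p).
Qed.

Lemma cube_compact : compact [set: cube].
Proof.
rewrite (_ : setT = [set f : cube | forall i, [set: bool] (f i)]).
  exact: tychonoff (fun=> bool_compact).
by rewrite eqEsubset.
Qed.

Lemma cube_coord_continuous i : continuous (fun x : cube => x i).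
Proof. exact: (@proj_continuous I (fun=> bool)). Qed.

End cube.

Lemma compact_set_type (T : topologicalType) (A : set T) :
  compact A -> compact [set: A].
Proof.
move=> cA F FF _; have FA : (set_val @ F) A.
  by apply: (@filterS _ F _ setT) => [z _|]; [exact: set_valP|exact: filterT].
have [a [Aa clFa]] := cA _ _ FA; exists (exist _ a (mem_set Aa)); split => //.
move=> B N FB [_ [[O oO <-] Oa ON]].
have [_ [[b Bb <-] Ob]] : (set_val @` B) `&` O !=set0.
  apply: clFa; last exact: open_nbhs_nbhs.
  by apply: (@filterS _ F _ B) => // b Bb; exists b.
by exists b; split=> //; exact: ON.
Qed.

Lemma zero_dimensional_hausdorff (T : topologicalType) :
  zero_dimensional T -> hausdorff_space T.
Proof.
move=> zT; rewrite open_hausdorff => x y /zT[U [[oU cU] Ux Uy]].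
exists (U, ~` U) => /=; first by split; apply/mem_set.
by split; rewrite ?setICr //; exact: closed_openC.
Qed.

Lemma zero_dimensional_totally_disconnected (T : topologicalType) (Y : set T) :
  zero_dimensional T -> totally_disconnected Y.
Proof.
move=> /zero_dimension_totally_disconnected tT x Yx; rewrite eqEsubset.
split=> [z [R [Rx RY cR Rz]]|_ ->]; last exact: connected_component_refl.
by rewrite -(tT x) //; exists R.
Qed.

(** * The Stone space of almost invariant sets *)

Section stone.
Variable G : groupType.
Local Notation cube := {ptws (set G) -> bool}.

(* The coordinates of sets that are not almost invariant are frozen to false,
   so that this is the Stone space of the Boolean algebra of almost invariant
   sets. *)
Definition indicators (h : G) : cube :=
  fun A => `[< almost_invariant A /\ A h >].

Definition stone := closure (range indicators).

Lemma stone_indicators h : stone (indicators h).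
Proof. exact/subset_closure/imageT. Qed.

Definition stone_inj (h : G) : stone := SigSub (mem_set (@stone_indicators h)).

Lemma stone_ext (x y : stone) : (forall A, \val x A = \val y A) -> x = y.
Proof. by move=> xy; apply: val_inj; apply/funext. Qed.

Lemma stone_coord_clopen (A : set G) (b : bool) :
  clopen [set z : stone | \val z A = b].
Proof.
have cA : continuous (fun z : stone => \val z A).
  move=> z.
  apply: (@continuous_comp stone cube bool set_val (fun x : cube => x A)).
    exact: initial_continuous.
  exact: cube_coord_continuous.
have cb : clopen [set b].
  by split; [exact: discrete_open | exact: discrete_closed].
exact: preimage_clopen cb cA.
Qed.

Lemma stone_zero_dimensional : zero_dimensional stone.
Proof.
move=> x y /eqP xy; have [A xyA] : exists A, \val x A <> \val y A.
  by apply/existsNP => H; apply: xy; exact: stone_ext.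
exists [set z : stone | \val z A = \val x A]; split => //=; last exact/nesym.
exact: stone_coord_clopen.
Qed.

Lemma stone_compact : compact [set: stone].
Proof.
apply: compact_set_type; apply: subclosed_compact (@cube_compact _) _ => //.
exact: closed_closure.
Qed.

Lemma stone_dense : dense (range stone_inj).
Proof.
move=> U [z Uz] [O oO OU]; have Oz : O (\val z) by move: Uz; rewrite -OU.
have [|_ [[h _ <-] Oh]] := set_valP z O; first exact: open_nbhs_nbhs.
by exists (stone_inj h); split; [rewrite -OU | exists h].
Qed.

Lemma stone_inj_injective : injective stone_inj.
Proof.
move=> g h /(congr1 (fun z : stone => \val z [set g])) /= /esym.
rewrite /indicators (_ : `[< _ /\ [set g] g >] = true); last first.
  by apply/asboolP; split=> //; exact: almost_invariant1.
by move=> /asboolP[_ ->].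
Qed.

Lemma stone_isolated h : open [set stone_inj h].
Proof.
rewrite (_ : [set _] = [set z : stone | \val z [set h] = true]).
  by case: (stone_coord_clopen [set h] true).
rewrite eqEsubset; split => [_ -> /=|z /= zh].
  by apply/asboolP; split=> //; exact: almost_invariant1.
apply: stone_ext => A; apply: contrapT => /= zA.
(* Density gives a group element with true [[set h]]-coordinate and the same [A]-coordinate as [z];
   the first condition forces it to be [h]. *)
have [||x [[xh xA] [g _ gx]]] :=
    @stone_dense ([set z : stone | \val z [set h] = true] `&`
                  [set x : stone | \val x A = \val z A]).
- by exists z.
- apply: openI; first by case: (stone_coord_clopen [set h] true).
  by case: (stone_coord_clopen A (\val z A)).
- move: xh xA; rewrite /= -gx /= => /asboolP[_ ->] xA; exact: zA.
Qed.

(** With a point of the cube read as a family of subsets of [G], this is its pushforward under left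
    translation by [g]. *)
Definition cube_act (g : G) (x : cube) : cube := fun A => x [set y | A (g * y)].

Lemma cube_act_continuous g : continuous (cube_act g).
Proof. by apply: cube_continuous => A; exact: cube_coord_continuous. Qed.

Lemma cube_act_indicators g h : cube_act g (indicators h) = indicators (g * h).
Proof.
apply/funext => A.
by rewrite /cube_act /indicators almost_invariant_lmulE.
Qed.

Lemma cube_act_stone g (x : stone) : stone (cube_act g (\val x)).
Proof.
move=> U /cube_act_continuous gU; have [_ [[h _ <-] Uh]] := set_valP x _ gU.
exists (indicators (g * h)); split; first by exists (g * h).
by rewrite -cube_act_indicators.
Qed.

Definition stone_act_fun (g : G) (x : stone) : stone :=
  SigSub (mem_set (@cube_act_stone g x)).

Lemma stone_act_fun1 x : stone_act_fun 1 x = x.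
Proof.
apply: stone_ext => A /=; rewrite /cube_act; congr (\val x _).
by apply/funext => y /=; rewrite mul1g.
Qed.

Lemma stone_act_funM g h x :
  stone_act_fun (g * h) x = stone_act_fun g (stone_act_fun h x).
Proof.
apply: stone_ext => A /=; rewrite /cube_act /=; congr (\val x _).
by apply/funext => y /=; rewrite mulgA.
Qed.

Lemma stone_act_fun_continuous g : continuous (stone_act_fun g).
Proof.
apply: continuous_comp_initial => x.
apply: (@continuous_comp _ _ _ (set_val : stone -> cube) (cube_act g)).
  exact: initial_continuous.
exact: cube_act_continuous.
Qed.

Definition stone_act : continuous_action G stone :=
  Build_continuous_action stone_act_fun1 stone_act_funM
    stone_act_fun_continuous.

Lemma stone_act_inj g h : stone_act g (stone_inj h) = stone_inj (g * h).
Proof. by apply: val_inj; exact: cube_act_indicators. Qed.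

(** Only finitely many coordinates [A] matter for [u], and for each pair [f], [f'] an almost
    invariant [A] separates [h * f] from [h * f'] for finitely many [h] only. *)
Lemma stone_perspective (u : set (stone * stone)) (F : set G) :
  entourage u -> finite_set F ->
  finite_set [set h | ~ small u (stone_inj @` [set h * f | f in F])].
Proof.
move=> [V entV Vu] finF; have [s fs sV] := cube_entourage entV.
pose bad A f f' := [set h : G |
  almost_invariant A /\ ~ (A (h * f) <-> A (h * f'))].
apply: (@sub_finite_set _ _ (\bigcup_(A in s) \bigcup_(f in F)
    \bigcup_(f' in F) bad A f f')).
  move=> h /= hF; apply: contrapT => nbad; apply: hF => -[x y] /=.
  move=> [[_ [f Ff <-] <-] [_ [f' Ff' <-] <-]]; apply/Vu/sV => A sA /=.
  have [aA|naA] := pselect (almost_invariant A); last first.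
    by apply: asbool_equiv_eq; split=> -[].
  apply: asbool_equiv_eq; suff AA : A (h * f) <-> A (h * f').
    by split=> -[_ /AA].
  apply: contrapT => nA; apply: nbad.
  by exists A => //; exists f => //; exists f'.
apply: bigcup_finite => // A _; apply: bigcup_finite => // f _.
apply: bigcup_finite => // f' _.
have [aA|naA] := pselect (almost_invariant A); last first.
  by apply: (@sub_finite_set _ _ set0) => // h [].
apply: sub_finite_set
  (finite_image (fun y => y * f^-1) (aA (f^-1 * f'))) => h [_ nA].
by exists (h * f); rewrite /= ?mulgK // mulgA mulgK.
Qed.

Definition stone_compactification : perspective_compactification G :=
  Build_perspective_compactification stone_compact
    (zero_dimensional_hausdorff stone_zero_dimensional) stone_inj_injective
    stone_isolated stone_dense stone_act_inj stone_perspective.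

End stone.

Lemma freudenthal_clopen (G : groupType) (X : perspective_compactification G)
    (A : set G) : is_freudenthal X -> almost_invariant A ->
  exists2 C : set X, clopen C & pc_inj X @^-1` C = A.
Proof.
move=> [_ maxX] aA; have [|f [[cf fi] _ _]] := maxX (stone_compactification G).
  exact: zero_dimensional_totally_disconnected (@stone_zero_dimensional G).
exists (f @^-1` [set z : set_type (@stone G) | \val z A = true]).
  exact: preimage_clopen (stone_coord_clopen A true) cf.
apply/seteqP; split=> h /=; rewrite fi; first by move=> /asboolP[].
by move=> Ah; apply/asboolP.
Qed.

(** * Inducing almost invariant sets along a homomorphism *)

Section induction.
Variables (G H : groupType) (j : UMagmaMorphism.type H G).
Variables (D : set G) (A : set H).
Hypothesis aD : almost_invariant D.
Hypothesis aA : almost_invariant A.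
Hypothesis cover : forall x, exists h, D (j h * x).
Hypothesis orbit_fin : forall x, finite_set [set h | D (j h * x)].
Hypothesis return_fin : finite_set [set h | exists2 d, D d & D (j h * d)].

(* Translates of D play the role of a fundamental domain for H acting on G by
   left multiplication: x is kept when every h with x \in j h D lies in A. *)
Definition induced : set G := [set x | forall h, D (j h * x) -> A h^-1].

(** Membership of [j h * x] means [A (h * k^-1)] for all [k] with [D (j k * x)]. These [k] are
    finite in number and at least one exists, and each condition agrees with [A h] for almost all
    [h]. *)
Lemma induced_orbit x : finite_set [set h | ~ (induced (j h * x) <-> A h)].
Proof.
apply: (@sub_finite_set _ _
    (\bigcup_(k in [set k | D (j k * x)]) [set h | ~ (A h <-> A (h * k^-1))])).
  move=> h /= nh; apply: contrapT => nbad; apply: nh.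
  have Ak k : D (j k * x) -> A h <-> A (h * k^-1).
    by move=> Dk; apply: contrapT => nA; apply: nbad; exists k.
  split=> [Bh|Ah k Dk].
    have [k Dk] := cover x; apply/(Ak k Dk).
    have := Bh (k * h^-1); rewrite invgM invgK; apply.
    by rewrite mulgA -gmulfM divgK.
  have := Ak (k * h); rewrite invgM mulVKg gmulfM -mulgA => /(_ Dk) Ahk.
  exact/Ahk.
by apply: bigcup_finite => // k _; exact: aA.
Qed.

Lemma induced_almost_invariant : almost_invariant induced.
Proof.
move=> g.
(* Every [x] is [j k0^-1 * d] with [d] in [D]. If [d] is in the finite set [S], [induced_orbit] at
   [d] and [d * g] leaves finitely many bad [x]; otherwise [x] and [x * g] lie in the same
   translates of [D]. *)
pose S := [set d | ~ (D d <-> D (d * g))] `|`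
  \bigcup_(k in [set k | exists2 d, D d & D (j k * d)])
     [set d | ~ (D (j k * d) <-> D (j k * d * g))].
have fS : finite_set S.
  rewrite finite_setU; split; first exact: aD.
  apply: bigcup_finite => // k _.
  have := almost_invariant_lmul (j k) aD g.
  by apply: sub_finite_set => d /=; rewrite mulgA.
pose bad d := [set h | ~ (induced (j h * d) <-> A h)].
apply: (@sub_finite_set _ _
  (\bigcup_(d in S) ((fun h => j h * d) @` (bad d `|` bad (d * g)))));
  last first.
  apply: bigcup_finite => // d _; apply: finite_image.
  by rewrite finite_setU; split; exact: induced_orbit.
move=> x /= nx; have [k0 Dk0] := cover x; set d := j k0 * x in Dk0.
have xE : x = j k0^-1 * d by rewrite gmulfV mulKg.
have [Sd|nSd] := pselect (S d).
  exists d => //; exists k0^-1 => //; apply: contrapT => /not_orP[nb nb'].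
  apply: nx; rewrite {1}xE (_ : x * g = j k0^-1 * (d * g)); last first.
    by rewrite mulgA -xE.
  by move: nb nb' => /contrapT -> /contrapT ->.
case: nx; have Ddg : D (d * g).
  by apply: contrapT => nD; apply: nSd; left=> -[/(_ Dk0)].
suff DD k : D (j k * x) <-> D (j k * (x * g)).
  by split=> Bx h /DD /Bx.
have kx : j k * x = j (k * k0^-1) * d by rewrite xE mulgA gmulfM.
(* If [k * k0^-1] returns some point of [D] to [D], then [S] controls it; if not, it takes neither
   [d] nor [d * g], both in [D], back into [D]. *)
rewrite mulgA kx; apply: contrapT => nD.
have [Fk|nFk] := pselect (exists2 d, D d & D (j (k * k0^-1) * d)).
  by apply: nSd; right; exists (k * k0^-1).
apply: nD; split=> [Dd|Dd]; case: nFk; first by exists d.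
by exists (d * g) => //; rewrite mulgA.
Qed.

End induction.

(** * Boundaries of perspective compactifications *)

Lemma pc_boundary_zero_dimensional (H : groupType)
    (X : perspective_compactification H) :
  totally_disconnected (pc_boundary X) -> zero_dimensional X.
Proof.
move=> tX; apply: (isolated_zero_dimensional (Y := pc_boundary X)) => //.
- exact: pc_hausdorff.
- exact: pc_compact.
- by move=> z /contrapT[h _ <-]; exact: pc_isolated.
Qed.

(** Removing a finite trace from [C] would leave a nonempty open set missing the dense group. *)
Lemma clopen_boundary_infinite (H : groupType)
    (X : perspective_compactification H) (C : set X) (y : X) :
  clopen C -> pc_boundary X y -> C y -> infinite_set (pc_inj X @^-1` C).
Proof.
move=> [oC _] Yy Cy finC.
have oU : open (C `\` (pc_inj X @` (pc_inj X @^-1` C))).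
  apply: openI => //; apply: closed_openC.
  have /accessible_finite_set_closed clf :=
    hausdorff_accessible (@pc_hausdorff _ X).
  by apply: clf; exact: finite_image.
have [|z [[Cz nz] [h _ hz]]] := @pc_dense _ X _ _ oU.
  by exists y; split=> // -[h _ hy]; apply: Yy; exists h.
by apply: nz; exists h; rewrite //= hz.
Qed.

(** The sets containing almost all of [H] form a proper filter; its cluster point cannot be an
    isolated group element. *)
Lemma pc_boundary_nonempty (H : groupType)
    (X : perspective_compactification H) :
  infinite_set [set: H] -> pc_boundary X !=set0.
Proof.
move=> infH; pose F := [set U : set X | finite_set (pc_inj X @^-1` (~` U))].
have FF : ProperFilter F.
  split; last split.
  - by rewrite /F /= setC0 preimage_setT.
  - by rewrite /F /= setCT preimage_set0.
  - by move=> U V; rewrite /F /= setCI preimage_setU finite_setU.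
  - move=> U V UV; rewrite /F /=; apply: sub_finite_set => h /=.
    exact/contra_not/UV.
have [e [_ Fe]] := pc_compact FF filterT.
exists e => -[h _ he]; have nh : nbhs e [set pc_inj X h].
  by rewrite -he; apply: open_nbhs_nbhs; split=> //; exact: pc_isolated.
have Fh : F (~` [set pc_inj X h]).
  rewrite /F /= setCK; apply: sub_finite_set (finite_set1 h) => k /=.
  exact: pc_injective.
by have [x []] := Fe _ _ Fh nh.
Qed.

(** * Orbits of the stabiliser near a parabolic point *)

Section parabolic.
Variables (G : groupType) (X : perspective_compactification G) (p : X).
Hypothesis Yp : pc_boundary X p.
Hypothesis pd : properly_discontinuous_on
  (stab_act (a := pc_act X) (p := p)) (~` [set p]).

(** Proper discontinuity is applied to the complement of an open neighbourhood of [p], enlarged by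
    the point [x]. *)
Lemma orbit_converges (U : set X) (x : G) : nbhs p U ->
  finite_set [set h : stab (pc_act X) p | ~ U (pc_inj X (\val h * x))].
Proof.
rewrite nbhsE => -[V [oV Vp] VU].
have cV : compact (~` V).
  by apply: subclosed_compact (@pc_compact _ X) _ => //; exact: open_closedC.
have [|fK] := pselect (~` V `|` [set pc_inj X x] `<=` ~` [set p]); last first.
  by case: fK => z [nVz zp|-> xp]; [apply: nVz; rewrite zp|apply: Yp; exists x].
move=> /(pd (compactU cV (@compact_set1 _ (pc_inj X x)))).
apply: sub_finite_set => h /= nU; exists (pc_inj X (\val h * x)); split.
  by exists (pc_inj X x); [right | rewrite /stab_act pc_act_inj].
by left=> /VU.
Qed.

(** Otherwise the complement of [C] is a neighbourhood of [p] and captures almost all of the orbit,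
    leaving [A] finite. *)
Lemma clopen_orbit (C : set X) (A : set (stab (pc_act X) p)) (x : G) :
  clopen C -> infinite_set A ->
  finite_set [set h | A h /\ ~ C (pc_inj X (\val h * x))] -> C p.
Proof.
move=> [_ cC] infA finAC; apply: contrapT => nCp; apply: infA.
have nC : nbhs p (~` C).
  by apply: open_nbhs_nbhs; split=> //; exact: closed_openC.
apply: (@sub_finite_set _ _ ([set h | ~ (~` C) (pc_inj X (\val h * x))] `|`
    [set h | A h /\ ~ C (pc_inj X (\val h * x))])); last first.
  by rewrite finite_setU; split=> //; exact: orbit_converges.
move=> h Ah /=.
by have [Ch|nCh] := pselect (C (pc_inj X (\val h * x))); [left; apply|right].
Qed.

End parabolic.

(** A finite stabiliser would make the complement of [p] a finite union of compact sets, so [p]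
    would be isolated, against density. *)
Lemma cocompact_stab_infinite (G : groupType)
    (X : perspective_compactification G) (p : X) :
  pc_boundary X p ->
  cocompact_on (stab_act (a := pc_act X) (p := p)) (~` [set p]) ->
  infinite_set [set: stab (pc_act X) p].
Proof.
move=> Yp [K [cK _ KX]] finH; have op : open [set p].
  rewrite -[[set p]]setCK -KX; apply: closed_openC.
  apply: closed_bigcup => // h _;
  apply: compact_closed; first exact: pc_hausdorff.
  apply: continuous_compact => //; apply: continuous_subspaceT.
  exact: act_continuous.
have [|q [-> ]] := @pc_dense _ X _ _ op; first by exists p.
exact: Yp.
Qed.

Lemma clopen_avoiding (T : topologicalType) (p : T) (K : set T) :
  hausdorff_space T -> compact [set: T] -> zero_dimensional T ->
  compact K -> K `<=` ~` [set p] -> exists2 L, clopen L /\ ~ L p & K `<=` L.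
Proof.
move=> hT cT zT cK Kp.
have nK : nbhs p (~` K).
  apply: open_nbhs_nbhs; split; last by move=> /Kp; exact.
  exact: closed_openC (compact_closed hT cK).
have [D [Dp cD] DK] := zero_dimensional_cvg hT zT cT nK.
exists (~` D); first by split; [exact: (clopenC D) | exact].
by move=> x Kx /DK; exact.
Qed.

(* The boundary of a Freudenthal compactification X of a group is its space of
   ends; E ranges over the Freudenthal compactifications of Stab p. *)
Theorem proposition3p23 (G : groupType) (X : perspective_compactification G)
    (p : X) :
  is_freudenthal X -> pc_boundary X p -> bounded_parabolic (pc_act X) p ->
  forall E : perspective_compactification (stab (pc_act X) p),
    is_freudenthal E -> pc_boundary E #= `I_1.
Proof.
move=> frX Yp [pd coc] E [tE _].
have [y Ey] := @pc_boundary_nonempty _ E (cocompact_stab_infinite Yp coc).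
suff -> : pc_boundary E = [set y] by exact: card_set1.
apply/seteqP; split=> [z Ez|_ -> //]; apply: contrapT => /eqP zy.
have [C [cC Cz Cy]] := pc_boundary_zero_dimensional tE zy.
pose A := pc_inj E @^-1` C.
have infA : infinite_set A := clopen_boundary_infinite cC Ez Cz.
have infA' : infinite_set (~` A).
  exact: (@clopen_boundary_infinite _ E (~` C) y (clopenC set0 cC)).
have aA : almost_invariant A := clopen_almost_invariant cC.
(* The trace [D] of [L] serves as fundamental domain: cocompactness gives [cover], proper
   discontinuity the two finiteness conditions. *)
have [K [cK Kp KX]] := coc.
have [L [cL Lp] KL] := clopen_avoiding (@pc_hausdorff _ X) (@pc_compact _ X)
  (pc_boundary_zero_dimensional frX.1) cK Kp.
pose j : UMagmaMorphism.type (stab (pc_act X) p) G := \val.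
pose D := pc_inj X @^-1` L.
have aD : almost_invariant D := clopen_almost_invariant cL.
have cover x : exists h, D (j h * x).
  have : (~` [set p]) (pc_inj X x) by move=> xp; apply: Yp; exists x.
  rewrite -KX => -[h _ [k /KL Lk hk]]; exists h^-1.
  rewrite /D /= -pc_act_inj -hk /stab_act -actM -(valM h^-1 h) mulVg val1 act1.
  exact: Lk.
have orbit_fin x : finite_set [set h | D (j h * x)].
  have nL : nbhs p (~` L).
    by apply: open_nbhs_nbhs; split=> //; apply: closed_openC; case: cL.
  apply: sub_finite_set (orbit_converges Yp pd x nL) => h /= Dh; exact.
have return_fin : finite_set [set h | exists2 d, D d & D (j h * d)].
  have cptL : compact L.
    by apply: subclosed_compact (@pc_compact _ X) _ => //; case: cL.
  have [|Lp'] := pselect (L `<=` ~` [set p]); last first.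
    by case: Lp' => x Lx xp; apply: Lp; rewrite -xp.
  move=> /(pd L cptL); apply: sub_finite_set => h [d Dd Dhd] /=.
  exists (pc_inj X (j h * d)); split=> //.
  by exists (pc_inj X d); rewrite // /stab_act pc_act_inj.
have aB := induced_almost_invariant aD aA cover orbit_fin return_fin.
have [V cV VB] := freudenthal_clopen frX aB.
(* The orbit of [1] is the stabiliser itself, on which the induced set thus agrees with [A] up to
   finitely many elements. *)
have fB := induced_orbit aA cover orbit_fin 1.
have Vp : V p.
  apply: (clopen_orbit Yp pd (x := 1) cV infA).
  apply: sub_finite_set fB => h [Ah nV] /= BA; apply: nV.
  by have /BA := Ah; rewrite -VB.
have Vp' : (~` V) p.
  apply: (clopen_orbit Yp pd (x := 1) (clopenC set0 cV) infA').
  apply: sub_finite_set fB => h [Ah nV] /= BA; apply: nV => Vh; apply: Ah.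
  by apply/BA; rewrite -VB.
exact: Vp'.
Qed.
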